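(* (Consecutive zero signals.) For a state value that starts with $\beta^{ck}$, where $c,k\in\mathbb{N}_+$, it takes $c\cdot s$ iterations of the exact EMA update to decay to $(\beta^c)^{k+s}$ if the subsequent signals are $z\equiv 0$. For the quantized EMA update using logarithmic quantization with base $\alpha=\beta^c$ and the stochastic rounding described in the context, the average number of iterations required to decay from $(\beta^c)^k$ to $(\beta^c)^{k+s}$ when all signals are zero is $$\mathbb{E}\big[(\beta^c)^k\to(\beta^c)^{k+s}\,\big|\,z\equiv 0\big]=cs,$$ which aligns with the real state decay.
   Context: The exact exponential moving average (EMA) update with momentum $\beta\in[0,1)$ and received signals $z_{t+1}$ is $x_{t+1}=\beta x_t+(1-\beta)z_{t+1}$. Logarithmic quantization with base $\alpha\in(0,1)$ and $b$ bits uses the levels $y_j=\alpha^j$, $j=0,1,\dots,2^b-1$. For a tensor $X$ with scale factor $\Delta=\max_{x\in X}|x|$, an entry $x$ is quantized to the random index $$Q(x)=\mathrm{Clip}\big(\lfloor\log_\alpha(x/\Delta)+\xi\rceil;\,0,\,2^b-1\big),$$ where $\xi\sim\mathcal{U}[-0.5,0.5]$, $\lfloor\cdot\rceil$ denotes convergent rounding to the nearest integer (ties to even, as in IEEE 754), and $\mathrm{Clip}(\cdot;0,2^b-1)$ clips to the range $[0,2^b-1]$. One quantized EMA update consists of: dequantization $\tilde x_t=y_{q_t}\cdot\Delta_t$; EMA update $\hat x_{t+1}=\beta\tilde x_t+(1-\beta)z_{t+1}$; quantization $q_{t+1}=Q(\hat x_{t+1})$, where $\Delta_t$ is the scale factor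 at step $t$. The quantized state value $(\beta^c)^j$ is the level $\alpha^j$, and $s$ is a positive integer. The notation $\mathbb{E}[(\beta^c)^k\to(\beta^c)^{k+s}\mid z\equiv0]$ denotes the expected number of quantized updates needed to pass from the state value $(\beta^c)^k$ to $(\beta^c)^{k+s}$ when all signals are zero.
   Formalization: The scale factor Δ_t is assumed constant over all steps and outcomes, only the tracked entry's signals are zero, and k+s ≤ 2^b−1; without constant Δ_t the claim fails (a one-entry tensor with zero signals gets index 0 after one step and never decays). *)

(* Defs.v *)
From mathcomp Require Import all_boot all_order all_algebra.
From mathcomp Require Import all_classical all_reals all_analysis.

Set Implicit Arguments.
Unset Strict Implicit.
Unset Printing Implicit Defensive.

Import Order.TTheory GRing.Theory Num.Theory.

Local Open Scope ring_scope.
Local Open Scope classical_set_scope.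

Section EMA.
Context {R : realType}.

Definition ema_step (beta x z : R) : R := beta * x + (1 - beta) * z.

(* The signal received by the step from time [t] to time [t.+1] is [z t.+1];
   [z 0] is never used. *)
Fixpoint ema (beta : R) (z : nat -> R) (x0 : R) (t : nat) : R :=
  if t is t'.+1 then ema_step beta (ema beta z x0 t') (z t) else x0.

(* Number of iterations until the sequence [u] first takes the value [v];
   it is [+oo] (the infimum of the empty set) if this never happens. *)
Definition first_time (u : nat -> R) (v : R) : \bar R :=
  ereal_inf [set t%:R%:E | t in [set t | u t = v]].

Definition level (alpha : R) (j : nat) : R := alpha ^+ j.

Definition log_base (alpha x : R) : R := ln x / ln alpha.

Definition round_half_even (x : R) : int :=
  let n := Num.floor x in
  let r := x - n%:~R in
  if r < 2^-1 then n
  else if 2^-1 < r then n + 1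
  else if (2 %| n)%Z then n else n + 1.

Definition clip (n lo hi : int) : int := Num.max lo (Num.min n hi).

(* An entry [x = 0] has [log_alpha 0 = +oo], which is clipped to the last
   level; this must be a separate case because the library sets [ln 0 = 0].
   Negative entries, on which the logarithm is undefined, are sent to the last
   level too.  The clipped integer is nonnegative, so [absz] loses nothing. *)
Definition quantize (alpha : R) (b : nat) (Delta xi x : R) : nat :=
  if x <= 0 then (2 ^ b - 1)%N
  else absz (clip (round_half_even (log_base alpha (x / Delta) + xi))
                  0 (Posz (2 ^ b - 1))).

Section Tensor.
Variable I : finType.

Definition scale_factor (X : I -> R) : R := \big[Num.max/0]_i `|X i|.

Record qtensor := QTensor { qindex : I -> nat; qscale : R }.

Definition dequantize (alpha : R) (S : qtensor) (i : I) : R :=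
  level alpha (qindex S i) * qscale S.

Definition quantize_tensor (alpha : R) (b : nat) (xi X : I -> R) : qtensor :=
  QTensor (fun i => quantize alpha b (scale_factor X) (xi i) (X i))
          (scale_factor X).

Definition qema_step (beta alpha : R) (b : nat) (z xi : I -> R)
    (S : qtensor) : qtensor :=
  quantize_tensor alpha b xi
    (fun i => ema_step beta (dequantize alpha S i) (z i)).

(* As in [ema], the step from [t] to [t.+1] uses [z t.+1] and [xi t.+1]. *)
Fixpoint qema (beta alpha : R) (b : nat) (z xi : nat -> I -> R)
    (S0 : qtensor) (t : nat) : qtensor :=
  if t is t'.+1 then
    qema_step beta alpha b (z t) (xi t) (qema beta alpha b z xi S0 t')
  else S0.

(* Value of the quantized state of entry [i], in units of the scale factor. *)
Definition state_value (alpha : R) (S : qtensor) (i : I) : R :=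
  level alpha (qindex S i).

End Tensor.

Lemma ltNhalf_half : - 2^-1 < 2^-1 :> R.
Proof. by rewrite gtrN// invr_gt0 ltr0n. Qed.

Section Random.
Context {d : measure_display} {T : measurableType d} (P : probability T R).

(* X ~ U[-0.5, 0.5] *)
Definition uniform_half (X : {RV P >-> R}) : Prop :=
  forall A : set R, measurable A ->
    distribution P X A = uniform_prob ltNhalf_half A.

Definition mutually_independent (J : eqType) (X : J -> {RV P >-> R}) : Prop :=
  forall (s : seq J) (A : J -> set R),
    uniq s -> (forall j, measurable (A j)) ->
    P (\bigcap_(j in [set` s]) (X j @^-1` A j)) =
    (\prod_(j <- s) P (X j @^-1` A j))%E.

End Random.

End EMA.

(* Main.v *)
(* When all signals vanish, an entry at level q is dequantized, multiplied by
   beta = alpha^(1/c) and re-quantized with the same scale, so the quantizer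
   rounds q + 1/c + xi.  Outside a null set this is q + 1 if xi > 1/2 - 1/c and
   q otherwise: the level counts the successes of independent trials of success
   probability p = 1/c (and is clipped at 2^b - 1).  The time of the s-th success
   is the sum over t of the indicators of {fewer than s successes before t}, and
   the probabilities F(t, s) of these events satisfy
   F(t, s+1) - F(t+1, s+1) = p (F(t, s+1) - F(t, s)); summing over t
   gives mean s / p = c s, since F(t, s) -> 0. *)
Require Import Defs.
From mathcomp Require Import all_boot all_order all_algebra.
From mathcomp Require Import all_classical all_reals all_analysis.
From mathcomp Require Import measurable_realfun ring lra zify.

Set Implicit Arguments.
Unset Strict Implicit.
Unset Printing Implicit Defensive.

Import Order.TTheory GRing.Theory Num.Theory.
Import numFieldNormedType.Exports.

Local Open Scope ring_scope.
Local Open Scope classical_set_scope.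

(** * Binomial tails and their sum over time *)

(* The probability of fewer than [m] successes in [t] independent trials of
   success probability [p]. *)
Fixpoint count_tail (R : realType) (p : R) (t m : nat) : R :=
  match t, m with
  | 0, _ => (0 < m)%:R
  | t'.+1, 0 => 0
  | t'.+1, m'.+1 => (1 - p) * count_tail p t' m + p * count_tail p t' m'
  end.

Lemma count_tail_ge0 (R : realType) (p : R) : 0 <= p <= 1 ->
  forall t m, 0 <= count_tail p t m.
Proof.
move=> /andP[p0 p1]; elim=> [|t IH] [|m] //=.
by apply: addr_ge0; apply: mulr_ge0 => //; rewrite subr_ge0.
Qed.

Lemma count_tail0 (R : realType) (p : R) t : count_tail p t 0 = 0.
Proof. by case: t. Qed.

(* The defining recursion, read as
   [F t m.+1 - F t.+1 m.+1 = p * (F t m.+1 - F t m)], telescopes over [t < n]. *)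
Lemma series_count_tailS (R : realType) (p : R) (n m : nat) : p != 0 ->
  series (count_tail p ^~ m.+1) n =
  series (count_tail p ^~ m) n + p^-1 * (1 - count_tail p n m.+1).
Proof.
move=> p0; rewrite /series /=; elim: n => [|n IH].
  by rewrite !big_geq//= subrr mulr0 addr0.
by rewrite !big_nat_recr//= IH; field.
Qed.

(** Dropping the nonnegative tail in [series_count_tailS], each further success costs at most
    [p^-1]. The bound is uniform in [n], which yields convergence. *)
Lemma series_count_tail_le (R : realType) (p : R) (n m : nat) : 0 < p <= 1 ->
  series (count_tail p ^~ m) n <= m%:R / p.
Proof.
move=> /andP[p0 p1]; elim: m => [|m IH].
  by rewrite mul0r /series/= big1// => t _; exact: count_tail0.
rewrite series_count_tailS ?gt_eqF// -natr1 mulrDl mul1r lerD//.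
rewrite ler_piMr ?invr_ge0 ?(ltW p0)// gerBl.
by apply: count_tail_ge0; rewrite (ltW p0).
Qed.

(** No estimate of binomial coefficients: the series has nonnegative terms and bounded partial sums,
    so it converges and its terms vanish. *)
Lemma cvg_count_tail (R : realType) (p : R) (m : nat) : 0 < p <= 1 ->
  (count_tail p t m) @[t --> \oo] --> 0.
Proof.
move=> p01; apply: cvg_series_cvg_0; apply: nondecreasing_is_cvgn.
  have /andP[p0 p1] := p01.
  apply/nondecreasing_series => t _ _ /=; apply: count_tail_ge0.
  by rewrite (ltW p0).
by exists (m%:R / p) => _ [n _ <-]; exact: series_count_tail_le.
Qed.

Lemma cvg_series_count_tail (R : realType) (p : R) (m : nat) : 0 < p <= 1 ->
  series (count_tail p ^~ m) @ \oo --> m%:R / p.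
Proof.
move=> p01; have /andP[p0 _] := p01; elim: m => [|m IH].
  rewrite mul0r (_ : series _ = cst 0); first exact: cvg_cst.
  apply/funext => n; rewrite /series/= big1// => t _; exact: count_tail0.
rewrite (_ : series _ = fun n => series (count_tail p ^~ m) n
    + p^-1 * (1 - count_tail p n m.+1)); last first.
  by apply/funext => n; rewrite series_count_tailS ?gt_eqF.
have -> : m.+1%:R / p = m%:R / p + p^-1 * (1 - 0).
  by rewrite -natr1 mulrDl mul1r subr0 mulr1.
apply: cvgD => //; apply: cvgMr; apply: cvgB; first exact: cvg_cst.
exact: cvg_count_tail.
Qed.

Lemma nneseries_count_tail (R : realType) (p : R) (m : nat) : 0 < p <= 1 ->
  (\sum_(0 <= t <oo) (count_tail p t m)%:E = (m%:R / p)%:E)%E.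
Proof.
move=> p01; apply/cvg_lim => //.
rewrite (_ : (fun n => _) = EFin \o series (count_tail p ^~ m)); last first.
  by apply/funext => n /=; rewrite sumEFin.
by apply: cvg_EFin; [exact: nearW|exact: cvg_series_count_tail].
Qed.

(** * Integrals of nonnegative functions that agree off a null set *)

Section negligible_integral.
Import HBNNSimple.

(* [f] and [g] may be nonmeasurable: a simple function below [f], set to 0 on
   [N], lies below [g] and keeps its integral. *)
Lemma le_nnintegral_negligible d (T : measurableType d) (R : realType)
    (mu : {measure set T -> \bar R}) (N : set T) (f g : T -> \bar R) :
  measurable N -> mu N = 0%E ->
  (forall x, 0 <= f x)%E -> (forall x, 0 <= g x)%E ->
  (forall x, ~ N x -> f x <= g x)%E ->
  (\int[mu]_x f x <= \int[mu]_x g x)%E.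
Proof.
move=> mN N0 f0 g0 fg; rewrite !ge0_integralTE//.
apply: ge_ereal_sup => _ [h /= hf <-].
apply: ereal_sup_ubound; exists (proj_nnsfun h (measurableC mN)).
  move=> x; rewrite /proj_nnsfun/= mindicE.
  have [xN|xN] := boolP (x \in ~` N).
    by rewrite mulr1; apply: le_trans (hf x) (fg _ _); rewrite inE in xN.
  by rewrite mulr0.
rewrite -(mrestrict _ (measurableC mN)).
rewrite -integral_nnsfun; last exact: measurableC.
rewrite -[RHS]integralT_nnsfun.
rewrite [RHS](ge0_negligible_integral mN)//; last 2 first.
  exact/measurable_EFinP.
  by move=> x _; rewrite lee_fin.
by rewrite setTD.
Qed.

Lemma eq_nnintegral_negligible d (T : measurableType d) (R : realType)
    (mu : {measure set T -> \bar R}) (N : set T) (f g : T -> \bar R) :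
  measurable N -> mu N = 0%E ->
  (forall x, 0 <= f x)%E -> (forall x, 0 <= g x)%E ->
  (forall x, ~ N x -> f x = g x) ->
  (\int[mu]_x f x = \int[mu]_x g x)%E.
Proof.
move=> mN N0 f0 g0 fg; apply/eqP; rewrite eq_le; apply/andP.
by split; apply: (le_nnintegral_negligible mN N0) => // x /fg ->.
Qed.

End negligible_integral.

(** * The uniform law of the rounding noise *)

Lemma uniform_half_probE (R : realType) (A : set R) : measurable A ->
  uniform_prob (@ltNhalf_half R) A =
  lebesgue_measure (A `&` `[- 2^-1, 2^-1]).
Proof.
move=> mA; rewrite /uniform_prob integral_uniform_pdf.
rewrite (eq_integral (cst 1%E)) ?integral_cst ?mul1e//; last first.
  move=> x; rewrite inE /= in_itv /= /uniform_pdf => -[_ ->].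
  congr EFin; by field.
exact: measurableI.
Qed.

Lemma uniform_half_gt (R : realType) (p : R) : 0 <= p <= 1 ->
  uniform_prob (@ltNhalf_half R) `]2^-1 - p, +oo[ = p%:E.
Proof.
move=> /andP[p0 p1]; rewrite uniform_half_probE//.
rewrite (_ : _ `&` _ = `]2^-1 - p, 2^-1]).
  rewrite lebesgue_measure_itv/= lte_fin.
  (* The second case is [p = 0], where the interval is empty. *)
  case: ifPn => h; first by rewrite -EFinB; congr EFin; lra.
  by congr EFin; lra.
apply/seteqP; split => x /=; rewrite !in_itv /= ?andbT.
  by move=> [-> /andP[]].
by move=> /andP[h ->]; split => //; rewrite andbT; lra.
Qed.

(** Within the closed support only three points are excluded: the two endpoints and the threshold,
    at which rounding would meet a tie. *)
Lemma uniform_half_typical (R : realType) (p : R) :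
  uniform_prob (@ltNhalf_half R) (~` (`]- 2^-1, 2^-1[ `\ (2^-1 - p))) = 0%E.
Proof.
have mA : measurable (~` (`]- 2^-1, 2^-1[ `\ (2^-1 - p)) : set R).
  by apply: measurableC; apply: measurableD.
rewrite uniform_half_probE//; apply: countable_lebesgue_measure0.
apply: (@sub_countable _ _ _ [set - 2^-1; 2^-1; 2^-1 - p]); last first.
  by apply: finite_set_countable.
apply: subset_card_le.
move=> x /= [nA]; rewrite in_itv /= => /andP[h1 h2].
apply: contrapT => nx; apply: nA; split; last by move=> xp; apply: nx; right.
rewrite /= in_itv /=; apply/andP; split; rewrite lt_neqAle ?h1 ?h2 andbT;
  apply/eqP => e; apply: nx; left; [left|right]; by rewrite e.
Qed.

(** * One quantized update with zero signal *)

(** The bounds are the range of [c%:R^-1 + xi]. In that range [1/2] is the only half-integer, so no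
    tie occurs and the result is [n] or [n + 1]. *)
Lemma round_half_even_add (R : realType) (n : nat) (y : R) :
  - 2^-1 < y -> y < 2^-1 + 1 -> y != 2^-1 ->
  round_half_even (n%:R + y) = (n + (2^-1 < y)%R)%N%:Z.
Proof.
move=> y1 y2 y3; rewrite /round_half_even.
(* Here [m] is the floor of [y], which can be -1, 0 or 1. *)
have floorE (m : int) : m%:~R <= y < (m + 1)%:~R ->
    Num.floor (n%:R + y) = n%:Z + m.
  move=> /andP[m1 m2]; apply: floor_def; rewrite !intrD lerD2l m1/=.
  by rewrite -addrA ltrD2l -intrD.
have [y0|y0] := ltP y 0.
  rewrite (floorE (-1)); last by rewrite addNr mulrN1z; apply/andP; split; lra.
  rewrite intrD mulrN1z.
  have -> : n%:R + y - (n%:~R - 1) = y + 1 :> R by rewrite -pmulrn; ring.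
  rewrite ifF; last by apply/negbTE; rewrite -leNgt; lra.
  rewrite ifT; last by lra.
  have /negbTE -> : ~~ (2^-1 < y) by rewrite -leNgt; lra.
  by rewrite subrK addn0.
have [y4|y4] := ltP y 1.
  rewrite (floorE 0) ?addr0; last by rewrite add0r y0 y4.
  have -> : n%:R + y - n%:~R = y :> R by rewrite -pmulrn; ring.
  (case: (ltgtP y 2^-1) => h).
  - by rewrite addn0.
  - by rewrite PoszD.
  - by rewrite h eqxx in y3.
(rewrite (floorE 1); last by apply/andP; split => //; rewrite intrD; lra).
rewrite intrD.
have -> : n%:R + y - (n%:~R + 1) = y - 1 :> R by rewrite -pmulrn; ring.
(rewrite ifT; last by lra).
have -> : 2^-1 < y by lra.
by rewrite PoszD.
Qed.

(** Since [beta] is the [c]-th root of the base, multiplying by it adds [1/c] to the logarithm. *)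
Lemma log_base_ema (R : realType) (beta : R) (c q : nat) :
  0 < beta < 1 -> (0 < c)%N ->
  log_base (beta ^+ c) (beta * level (beta ^+ c) q) = q%:R + c%:R^-1.
Proof.
move=> /andP[b0 b1] c0; rewrite /log_base /level -exprM.
have lnb : ln beta != 0 by rewrite lt_eqF// ln_lt0// b0.
have c0R : c%:R != 0 :> R by rewrite pnatr_eq0 -lt0n.
rewrite lnM ?posrE ?exprn_gt0// !lnXn//.
rewrite -(mulr_natr (ln beta) c) -(mulr_natr (ln beta) (c * q)) natrM.
by field; rewrite c0R lnb.
Qed.

Lemma clip_posz (n M : nat) : clip n%:Z 0 M%:Z = (minn n M)%:Z.
Proof. by rewrite /clip; lia. Qed.

Lemma quantize_ema_zero (R : realType) (beta : R) (c q b : nat) (Delta xi : R) :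
  0 < beta < 1 -> (0 < c)%N -> 0 < Delta ->
  - 2^-1 < xi < 2^-1 -> xi != 2^-1 - c%:R^-1 ->
  quantize (beta ^+ c) b Delta xi
    (ema_step beta (level (beta ^+ c) q * Delta) 0) =
  minn (q + (2^-1 - c%:R^-1 < xi)%R) (2 ^ b - 1).
Proof.
move=> b01 c0 D0 /andP[xi1 xi2] xi3; have /andP[b0 b1] := b01.
rewrite /ema_step mulr0 addr0 /quantize ifF; last first.
  by apply/negbTE; rewrite -ltNge !mulr_gt0// exprn_gt0// exprn_gt0.
rewrite mulrA mulfK ?gt_eqF// log_base_ema// -addrA.
have /andP[c1 c2] : 0 < (c%:R^-1 : R) <= 1.
  by rewrite invr_gt0 ltr0n c0/= invf_le1 ?ltr0n// ler1n.
have -> : (2^-1 - c%:R^-1 < xi) = (2^-1 < c%:R^-1 + xi) by rewrite ltrBlDl.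
rewrite round_half_even_add ?clip_posz//.
- by lra.
- by lra.
- by apply: contraNneq xi3 => h; apply/eqP; lra.
Qed.

(** * Hitting times as series of indicators *)

Lemma first_time_attained (R : realType) (u : nat -> R) (v : R) (t : nat) :
  u t = v -> (forall t', u t' = v -> (t <= t')%N) ->
  first_time u v = t%:R%:E.
Proof.
move=> ut tmin; apply/eqP; rewrite eq_le; apply/andP; split.
  by apply: ereal_inf_lbound; exists t.
by apply: le_ereal_inf_tmp => _ [t' /tmin tt' <-]; rewrite lee_fin ler_nat.
Qed.

Lemma first_time_never (R : realType) (u : nat -> R) (v : R) :
  (forall t, u t <> v) -> first_time u v = +oo%E.
Proof.
move=> uv; rewrite /first_time (_ : [set _ | _ in _] = set0) ?ereal_inf0//.
by apply/seteqP; split => // _ [t /= ut _]; exact: (uv t).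
Qed.

(* Both sides are the first time at which the counter [N] reaches [s]. *)
Lemma first_time_series (R : realType) (u : nat -> R) (v : R)
    (N : nat -> nat) (s : nat) :
  N 0%N = 0%N -> (forall t, N t <= N t.+1 <= (N t).+1)%N ->
  (forall t, u t = v -> (s <= N t)%N) -> (forall t, N t = s -> u t = v) ->
  first_time u v = (\sum_(0 <= t <oo) (N t < s)%:R%:E)%E.
Proof.
move=> N0 NS uN Nu.
have Nmono : {homo N : t t' / (t <= t')%N}.
  apply: homo_leq => [//|n m q|t]; first exact: leq_trans.
  by have /andP[] := NS t.
have ge0 t : (0 <= (N t < s)%N%:R%:E :> \bar R)%E by rewrite lee_fin.
have [[t0 st0]|nost] := pselect (exists t, s <= N t)%N; last first.
  have Ns t : (N t < s)%N.
    by rewrite ltnNge; apply/negP => st; apply: nost; exists t.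
  (* The counter stays below [s]: all terms are 1, so the series diverges, and the value is never
     taken. *)
  rewrite first_time_never => [|t /uN]; last by rewrite leqNgt Ns.
  apply/esym/eqyP => r r0.
  apply: le_trans (nneseries_lim_ge (Num.truncn r).+1 _) => [|//].
  under eq_bigr do rewrite Ns.
  rewrite sumEFin sumr_const_nat subn0 lee_fin ltW//.
  exact: truncnS_gt.
have exs : exists t, (s <= N t)%N by exists t0.
case: (ex_minnP exs) => {}t0 {}st0 tmin {exs}.
have lt_t0 t : (N t < s)%N = (t < t0)%N.
  apply/idP/idP => h; last first.
    by rewrite ltnNge; apply/negP => /tmin; rewrite leqNgt h.
  by rewrite ltnNge; apply/negP => /Nmono; rewrite leqNgt (leq_trans h).
(* Increments are at most one, so the counter cannot jump over [s]. *)
have Nt0 : N t0 = s.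
  apply/eqP; rewrite eqn_leq st0 andbT.
  case: t0 {tmin st0} lt_t0 => [|t1] lt_t0; first by rewrite N0.
  have /andP[_ /leq_trans] := NS t1; apply; by rewrite lt_t0.
rewrite (first_time_attained (Nu _ Nt0)); last by move=> t /uN /tmin.
rewrite (nneseries_split 0 t0)// add0n.
rewrite [X in (_ + X)%E]eseries0 ?adde0; last first.
  by move=> t t0t _; rewrite lt_t0 ltnNge t0t.
under eq_big_nat => t /andP[_ tt0] do rewrite lt_t0 tt0.
by rewrite sumEFin sumr_const_nat subn0.
Qed.

(** * Counting successes in independent trials *)

Definition count (T : Type) (E : nat -> set T) (w : T) (t : nat) : nat :=
  (\sum_(u < t) (w \in E u))%N.

Definition signed_event (T : Type) (E : nat -> set T) (b : nat -> bool)
    (j : nat) : set T := if b j then E j else ~` E j.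

(** Independence is stated for all finite patterns of successes and failures, so that splitting on
    the outcome of one more trial stays within this form. *)
Definition bernoulli_trials d (T : measurableType d) (R : realType)
    (P : probability T R) (p : R) (E : nat -> set T) : Prop :=
  forall (l : seq nat) (b : nat -> bool), uniq l ->
    P (\bigcap_(j in [set` l]) signed_event E b j) =
    (\prod_(j <- l) (if b j then p else 1 - p))%:E.

Lemma countS (T : Type) (E : nat -> set T) (w : T) (t : nat) :
  count E w t.+1 = (count E w t + (w \in E t))%N.
Proof. by rewrite /count big_ord_recr. Qed.

Lemma measurable_count_lt d (T : measurableType d) (E : nat -> set T) :
  (forall t, measurable (E t)) ->
  forall t m, measurable [set w | count E w t < m]%N.
Proof.
move=> mE; elim=> [|t IH] m.
  rewrite (_ : [set _ | _] = [set _ | (0 < m)%N]); last first.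
    by apply/seteqP; split => w; rewrite /= /count big_ord0.
  by case: (0 < m)%N; [rewrite set_true|rewrite set_false].
rewrite (_ : [set _ | _] = ([set w | count E w t < m]%N `&` ~` E t) `|`
    ([set w | count E w t < m.-1]%N `&` E t)).
  by apply: measurableU; apply: measurableI => //; exact: measurableC.
apply/seteqP; split => w; rewrite /= countS.
  have [wE|wE] := boolP (w \in E t).
    by move=> h; right; split; [lia|rewrite inE in wE].
  by rewrite addn0 => h; left; split => //; rewrite notin_setE in wE.
move=> [[h wE]|[h wE]]; first by rewrite memNset// addn0.
by rewrite mem_set//; lia.
Qed.

(** The claim is strengthened for induction on [t]: the count before [t] is taken jointly with any
    pattern on trials from [t] on. Splitting on trial [t] moves that trial into the pattern and
    reproduces the recursion of [count_tail]. *)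
Lemma prob_count_lt_signed d (T : measurableType d) (R : realType)
    (P : probability T R) (p : R) (E : nat -> set T) :
  (forall t, measurable (E t)) -> bernoulli_trials P p E ->
  forall t m (l : seq nat) b, uniq l -> all (leq t) l ->
  P ([set w | count E w t < m]%N `&` \bigcap_(j in [set` l]) signed_event E b j)
  = (count_tail p t m * \prod_(j <- l) (if b j then p else 1 - p))%:E.
Proof.
move=> mE trials; elim=> [|t IH] m l b ul tl.
  rewrite (_ : [set _ | _] = [set _ | (0 < m)%N]); last first.
    by apply/seteqP; split => w; rewrite /= /count big_ord0.
  case: m => [|m] /=.
    rewrite mul0r (_ : [set _ | _] = set0) ?set0I ?measure0//.
    by apply/seteqP; split.
  rewrite mul1r (_ : [set _ | _] = setT) ?setTI ?trials//.
  by apply/seteqP; split.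
case: m => [|m].
  rewrite count_tail0 mul0r (_ : [set _ | _] = set0) ?set0I ?measure0//.
  by apply/seteqP; split.
have tNl : t \notin l by apply/negP => /(allP tl); rewrite ltnn.
have utl : uniq (t :: l) by rewrite /= tNl.
have ttl : all (leq t) (t :: l).
  by rewrite /= leqnn; apply: sub_all tl => j /ltnW.
(* The pattern [b] extended by the outcome [v] of trial [t]. *)
pose b' v (j : nat) := if j == t then v else b j.
have b'E v j : j \in l -> b' v j = b j.
  by rewrite /b'; case: eqP => // -> tl'; rewrite tl' in tNl.
have capE v : \bigcap_(j in [set` t :: l]) signed_event E (b' v) j =
    (if v then E t else ~` E t) `&` \bigcap_(j in [set` l]) signed_event E b j.
  rewrite !bigcap_seq big_cons /signed_event {1}/b' eqxx; congr (_ `&` _).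
  by apply: eq_big_seq => j /b'E ->.
have prodE v : \prod_(j <- t :: l) (if b' v j then p else 1 - p) =
    (if v then p else 1 - p) * \prod_(j <- l) (if b j then p else 1 - p).
  rewrite big_cons {1}/b' eqxx; congr (_ * _).
  by apply: eq_big_seq => j /b'E ->.
have mcap : measurable (\bigcap_(j in [set` l]) signed_event E b j).
  rewrite bigcap_seq; apply: bigsetI_measurable => j _; rewrite /signed_event.
  by case: ifP => _ //; exact: measurableC.
(* If trial [t] fails, the earlier count must be below [m.+1]; if it succeeds, below [m]. *)
rewrite (_ : [set w | _] `&` _ =
    ([set w | count E w t < m.+1]%N `&`
      \bigcap_(j in [set` t :: l]) signed_event E (b' false) j) `|`
    ([set w | count E w t < m]%N `&`
      \bigcap_(j in [set` t :: l]) signed_event E (b' true) j)); last first.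
  rewrite !capE !setIA -setIUl; congr (_ `&` _).
  apply/seteqP; split => w; rewrite /= countS.
    have [wE|wE] := boolP (w \in E t).
      by move=> h; right; split; [lia|rewrite inE in wE].
    by rewrite addn0 => h; left; split => //; rewrite notin_setE in wE.
  move=> [[h wE]|[h wE]]; first by rewrite memNset// addn0.
  by rewrite mem_set//; lia.
rewrite measureU; last 3 first.
- rewrite capE; apply: measurableI; first exact: measurable_count_lt.
  by apply: measurableI => //; exact: measurableC.
- rewrite capE; apply: measurableI; first exact: measurable_count_lt.
  by apply: measurableI.
- by rewrite !capE; apply/seteqP; split => // w [[_ [? _]] [_ [? _]]].
have IH1 := IH m.+1 _ (b' false) utl ttl; have IH0 := IH m _ (b' true) utl ttl.
etransitivity; first exact: (congr2 adde IH1 IH0).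
by rewrite !prodE; congr EFin => /=; ring.
Qed.

Lemma prob_count_lt d (T : measurableType d) (R : realType)
    (P : probability T R) (p : R) (E : nat -> set T) (t m : nat) :
  (forall t, measurable (E t)) -> bernoulli_trials P p E ->
  P [set w | count E w t < m]%N = (count_tail p t m)%:E.
Proof.
move=> mE trials.
have := prob_count_lt_signed mE trials m (t := t) (l := [::]) xpredT isT isT.
by rewrite set_nil bigcap_set0 setIT big_nil mulr1.
Qed.

(** * Exact and quantized trajectories under zero signals *)

Lemma ema_zero (R : realType) (beta : R) (z : nat -> R) (x0 : R) (t : nat) :
  (forall t, z t = 0) -> ema beta z x0 t = beta ^+ t * x0.
Proof.
move=> z0; elim: t => [|t IH] /=; first by rewrite mul1r.
by rewrite IH /ema_step z0 mulr0 addr0 mulrA -exprS.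
Qed.

Lemma first_time_ema_zero (R : realType) (beta : R) (z : nat -> R) (m n : nat) :
  0 < beta < 1 -> (forall t, z t = 0) ->
  first_time (ema beta z (beta ^+ m)) (beta ^+ (n + m)) = n%:R%:E.
Proof.
move=> /andP[b0 b1] z0; apply: first_time_attained => [|t].
  by rewrite ema_zero// exprD.
rewrite ema_zero// -exprD => /(ieexprIn b0 (negbT (lt_eqF b1))) /eqP.
by rewrite eqn_add2r => /eqP ->.
Qed.

(** Clipping at every step amounts to clipping the total once, because increments are
    nonnegative. *)
Lemma qindex_qema_zero (R : realType) (beta : R) (c b : nat) (I : finType)
    (i : I) (z xi : nat -> I -> R) (S0 : qtensor I) :
  let S := qema beta (beta ^+ c) b z xi S0 in
  0 < beta < 1 -> (0 < c)%N ->
  0 < qscale S0 -> (forall t, qscale (S t) = qscale S0) ->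
  (qindex S0 i <= 2 ^ b - 1)%N -> (forall t, z t i = 0) ->
  (forall t, - 2^-1 < xi t.+1 i < 2^-1 /\ xi t.+1 i != 2^-1 - c%:R^-1) ->
  forall t, qindex (S t) i =
    minn (qindex S0 i + \sum_(u < t) (2^-1 - c%:R^-1 < xi u.+1 i)%R)
         (2 ^ b - 1).
Proof.
move=> S b01 c0 D0 Dt qb z0 typ; elim=> [|t IH].
  by rewrite big_ord0 addn0 /S /=; apply/esym/minn_idPl.
have [xi1 xi2] := typ t.
rewrite [LHS]/= -/(S t).
(* This scale factor is by definition the scale at time [t.+1], hence the initial one. *)
have -> : scale_factor (fun j => ema_step beta
    (dequantize (beta ^+ c) (S t) j) (z t.+1 j)) = qscale S0.
  by rewrite -(Dt t.+1).
rewrite z0 /dequantize Dt quantize_ema_zero// IH big_ord_recr/=.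
by lia.
Qed.

(** * Expected decay time *)

Lemma bernoulli_trials_thr d (T : measurableType d) (R : realType)
    (P : probability T R) (p : R) (X : nat -> {RV P >-> R}) :
  0 <= p <= 1 -> (forall t, uniform_half (X t)) -> mutually_independent X ->
  bernoulli_trials P p (fun t => X t.+1 @^-1` `]2^-1 - p, +oo[).
Proof.
move=> p01 unif indep l b ul.
have mE : measurable (`]2^-1 - p, +oo[ : set R) by [].
(* Trial [t] reads the noise of time [t.+1], whence the predecessor. *)
pose A (j : nat) : set R :=
  if b j.-1 then `]2^-1 - p, +oo[ else ~` `]2^-1 - p, +oo[.
have mA j : measurable (A j).
  by rewrite /A; case: ifP => _ //; exact: measurableC.
have PA j : P (X j.+1 @^-1` A j.+1) = (if b j then p else 1 - p)%:E.
  transitivity (uniform_prob (@ltNhalf_half R) (A j.+1)).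
    exact: (unif j.+1 _ (mA j.+1)).
  rewrite /A/=; case: ifP => _; first exact: uniform_half_gt.
  rewrite probability_setC// EFinB; congr (1 - _)%E.
  exact: uniform_half_gt.
rewrite (_ : \bigcap_(j in _) _ =
    \bigcap_(j in [set` map S l]) (X j @^-1` A j)).
  rewrite indep ?map_inj_uniq//; last exact: succn_inj.
  rewrite big_map (big_morph EFin EFinM erefl); apply: eq_bigr => j _.
  exact: PA.
rewrite !bigcap_seq big_map; apply: eq_bigr => j _.
by rewrite /signed_event /A/=; case: ifP.
Qed.

(** The terms are nonnegative and measurable, so sum and integral commute, and each indicator
    integrates to a binomial tail. *)
Lemma integral_count_lt d (T : measurableType d) (R : realType)
    (P : probability T R) (p : R) (E : nat -> set T) (s : nat) : 0 < p <= 1 ->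
  (forall t, measurable (E t)) -> bernoulli_trials P p E ->
  (\int[P]_w \sum_(0 <= t <oo) (count E w t < s)%N%:R%:E = (s%:R / p)%:E)%E.
Proof.
move=> p01 mE trials.
have indicE' t : (fun w => (count E w t < s)%N%:R%:E) =
    (fun w => (\1_[set w | count E w t < s]%N w)%:E : \bar R).
  by apply/funext => w; rewrite indicE mem_setE.
have mC t := measurable_count_lt mE t s.
rewrite integral_nneseries//; last first.
  by move=> t; rewrite indicE'; apply/measurable_EFinP; exact: measurable_indic.
rewrite -(nneseries_count_tail s p01); apply: eq_eseriesr => t _.
rewrite indicE' integral_indic// setIT; exact: prob_count_lt.
Qed.

Theorem proposition3p5 (R : realType) (d : measure_display)
  (T : measurableType d) (P : probability T R)
  (beta : R) (c k s b : nat)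
  (hbeta : 0 <= beta < 1) (hc : (0 < c)%N) (hk : (0 < k)%N) (hs : (0 < s)%N)
  (halpha : 0 < beta ^+ c < 1)
  (hlevel : (k + s <= 2 ^ b - 1)%N)
  (I : finType) (i : I)
  (z xi : nat -> I -> {RV P >-> R})
  (hxi_unif : forall t j, uniform_half (xi t j))
  (hxi_indep : mutually_independent (fun t => xi t i))
  (S0 : qtensor I) (hS0 : qindex S0 i = k) (hDelta0 : 0 < qscale S0)
  (S : T -> nat -> qtensor I)
  (hS : forall w t, S w t =
     qema beta (beta ^+ c) b (fun t j => z t j w) (fun t j => xi t j w) S0 t)
  (hDelta : forall w t, qscale (S w t) = qscale S0)
  (hz : forall t w, z t i w = 0) :
  (forall w,
     first_time (ema beta (fun t => z t i w) (beta ^+ (c * k)))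
                ((beta ^+ c) ^+ (k + s)) = (c * s)%:R%:E) /\
  (\int[P]_w first_time (fun t => state_value (beta ^+ c) (S w t) i)
                        ((beta ^+ c) ^+ (k + s)))%E = (c * s)%:R%:E.
Proof.
(* If [beta] were 0, so would be [beta ^+ c], as [c] is positive. *)
have beta01 : 0 < beta < 1.
  have /andP[b0 ->] := hbeta; rewrite andbT lt_neqAle b0 andbT.
  by apply: contraTneq halpha => <-; rewrite expr0n eqn0Ngt hc ltxx.
split=> [w|].
  by rewrite -exprM mulnDr addnC first_time_ema_zero.
have p01 : 0 < (c%:R^-1 : R) <= 1.
  by rewrite invr_gt0 ltr0n hc/= invf_le1 ?ltr0n// ler1n.
pose thr : set R := `]2^-1 - c%:R^-1, +oo[.
have mthr : measurable thr by exact: measurable_itv.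
pose typ : set R := `]- 2^-1, 2^-1[ `\ (2^-1 - c%:R^-1).
pose E t := xi t.+1 i @^-1` thr.
(* The exceptional null set: at some time the noise leaves the open interval or hits the
   threshold. *)
pose N := \bigcup_t (xi t.+1 i @^-1` ~` typ).
have mtyp : measurable (~` typ) by apply: measurableC; exact: measurableD.
have mpre (A : set R) t : measurable A -> measurable (xi t i @^-1` A).
  by move=> mA; rewrite -[X in measurable X]setTI; exact: measurable_funP.
have mN : measurable N by apply: bigcup_measurable => t _; exact: mpre.
have N0 : P N = 0%E.
  apply/negligibleP => //; apply: negligible_bigcup => t.
  apply/negligibleP; first exact: mpre.
  apply: etrans (uniform_half_typical c%:R^-1).
  exact: (hxi_unif t.+1 i _ mtyp).
have trials : bernoulli_trials P c%:R^-1 E.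
  apply: (@bernoulli_trials_thr _ _ _ _ _ (fun t => xi t i)) => //.
  by have /andP[/ltW -> ->] := p01.
have -> : (c * s)%:R%:E = (s%:R / c%:R^-1)%:E :> \bar R.
  by rewrite invrK natrM mulrC.
rewrite -(integral_count_lt s p01 _ trials); last first.
  by move=> t; exact: (mpre thr _ mthr).
(* Pointwise equality off [N] suffices, so measurability of the hitting time does not have to be
   established. *)
apply: (eq_nnintegral_negligible mN N0).
- move=> w; apply: le_ereal_inf_tmp => _ [t _ <-].
  by rewrite lee_fin.
- by move=> w; apply: nneseries_ge0 => t _ _; rewrite lee_fin.
move=> w Nw.
have countE t : count E w t =
    (\sum_(u < t) (2^-1 - c%:R^-1 < xi u.+1 i w)%R)%N.
  apply: eq_bigr => u _; congr nat_of_bool.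
  by apply/idP/idP; rewrite inE /E /thr /= in_itv /= andbT.
have qE t : qindex (S w t) i = minn (k + count E w t) (2 ^ b - 1).
  rewrite hS qindex_qema_zero ?hS0 ?countE//.
  - by move=> t'; rewrite -hS hDelta.
  - by apply: leq_trans hlevel; exact: leq_addr.
  - move=> t'; have : typ (xi t'.+1 i w).
      by apply: contrapT => nt; apply: Nw; exists t'.
    by rewrite /typ /= in_itv /= => -[-> /eqP].
have levelE t : (level (beta ^+ c) (qindex (S w t) i) =
    (beta ^+ c) ^+ (k + s)) <-> qindex (S w t) i = (k + s)%N.
  have /andP[a0 a1] := halpha.
  split=> [|->//]; exact: (ieexprIn a0 (negbT (lt_eqF a1))).
apply: first_time_series.
- by rewrite /count big_ord0.
- by move=> t; rewrite countS leq_addr -addn1 leq_add2l leq_b1.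
(* Clipping only lowers the index, so index [k + s] forces at least [s] successes. Equality can fail
   when [k + s] is the last level, where later successes leave the state unchanged. *)
- by move=> t /levelE kst; rewrite -(leq_add2l k) -kst qE geq_minl.
(* After exactly [s] successes the index [k + s] is within range by [hlevel], so it is not
   clipped. *)
- by move=> t ts; apply/levelE; rewrite qE ts; exact/minn_idPl.
Qed.
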